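(* Let $I\subset\mathbb{R}$ be an interval, and let $f,f':I\to I$ be continuous unimodal maps with turning points $c,c'\in\mathrm{Int}\,I$ respectively. Let $\mathcal{O}_1,\ldots,\mathcal{O}_r$ be distinct periodic orbits of $f$ and $\mathcal{O}'_1,\ldots,\mathcal{O}'_r$ distinct periodic orbits of $f'$. Let $m_i\in\mathcal{O}_i$ be the maximum point of $\mathcal{O}_i$, i.e. $f(m_i)=\max\mathcal{O}_i$, and let $m'_i\in\mathcal{O}'_i$ be the maximum point of $\mathcal{O}'_i$, i.e. $f'(m'_i)=\max\mathcal{O}'_i$. Suppose that for each $i$: (i) $\mathcal{O}_i$ and $\mathcal{O}'_i$ correspond to the same cycle in $\Delta_\star$, i.e. $f|_{\mathcal{O}_i}$ and $f'|_{\mathcal{O}'_i}$ have the same permutation type; and (ii) either $m_i\le c$ and $m'_i\le c'$, or $m_i\ge c$ and $m'_i\ge c'$. Then the finite bijections $f|_{\bigcup_i\mathcal{O}_i}$ and $f'|_{\bigcup_i\mathcal{O}'_i}$ have identical permutation type.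
   Context: A continuous map $f:I\to I$ is unimodal with turning point $c\in\mathrm{Int}\,I$ if it is strictly increasing on $\{x\in I: x\le c\}$ and strictly decreasing on $\{x\in I: x\ge c\}$. Let $I_n=\{1,\ldots,n\}$. For a finite set $J\subset\mathbb{R}$ with $n$ elements, $\Omega_J:I_n\to J$ denotes the unique increasing bijection. If $J\subset I$ is finite and $f(J)=J$, the permutation type of $f|_J$ is the permutation $\Omega_J^{-1}\circ f\circ\Omega_J$ of $I_n$. It is a unimodal permutation $\delta$: there is $m\in I_n$ such that $a<b\le m$ implies $\delta(a)<\delta(b)$ and $m\le a<b$ implies $\delta(a)>\delta(b)$. $\Delta_\star$ denotes the set of all unimodal permutations (of $I_n$, for some $n\ge1$) that consist of a single $n$-cycle. The permutation type of a periodic orbit lies in $\Delta_\star$. *)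

(* Defs.v *)
From mathcomp Require Import all_boot all_order all_algebra all_fingroup.
From mathcomp Require Import all_classical all_reals all_analysis.
Set Implicit Arguments.
Unset Strict Implicit.
Unset Printing Implicit Defensive.
Import Order.TTheory GRing.Theory Num.Theory.
Import numFieldNormedType.Exports.
Local Open Scope classical_set_scope.
Local Open Scope ring_scope.

(* A self-map of I is represented by a total function f : R -> R preserving I;
   its values outside I play no role. *)
Definition unimodal (R : realType) (I : set R) (f : R -> R) (c : R) : Prop :=
  [/\ set_fun I I f,
      {within I, continuous f},
      I° c,
      {in [set x | I x /\ x <= c] &, {homo f : x y / x < y}} &
      {in [set x | I x /\ c <= x] &, {homo f : x y /~ x < y}}].

Definition periodic_orbit (R : realType) (I : set R) (f : R -> R)
    (O : set R) : Prop :=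
  exists x n, [/\ I x, (0 < n)%N, iter n f x = x &
                  O = range (fun k => iter k f x)].

Definition is_max (R : realType) (J : set R) (y : R) : Prop :=
  J y /\ ubound J y.

Definition max_point (R : realType) (f : R -> R) (O : set R) (m : R) : Prop :=
  O m /\ is_max O (f m).

(* Omega is the increasing bijection from 'I_n onto J; it exists for exactly one
   n when J is finite, and is then unique. Indices start at 0 rather than 1. *)
Definition increasing_bij (R : realType) (J : set R) n (Omega : 'I_n -> R) :
    Prop :=
  set_bij setT J Omega /\ {homo Omega : i j / (i < j)%N >-> i < j}.

(* s = Omega^-1 \o f \o Omega *)
Definition perm_type (R : realType) (f : R -> R) (J : set R) n (s : 'S_n) :
    Prop :=
  exists Omega : 'I_n -> R,
    increasing_bij J Omega /\ forall i, f (Omega i) = Omega (s i).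

Definition same_perm_type (R : realType) (f : R -> R) (J : set R)
    (f' : R -> R) (J' : set R) : Prop :=
  exists n (s : 'S_n), perm_type f J s /\ perm_type f' J' s.

Definition unimodal_perm n (s : 'S_n) : Prop :=
  exists m : 'I_n,
    (forall a b : 'I_n, (a < b <= m)%N -> (s a < s b)%N) /\
    (forall a b : 'I_n, (m <= a < b)%N -> (s b < s a)%N).

Definition Delta_star n (s : 'S_n) : Prop :=
  unimodal_perm s /\ #|porbits s| = 1%N.

Definition same_cycle_Delta_star (R : realType) (f : R -> R) (O : set R)
    (f' : R -> R) (O' : set R) : Prop :=
  exists n (s : 'S_n), [/\ Delta_star s, perm_type f O s & perm_type f' O' s].

(* Hence, on periodic orbits of unimodal maps, same_cycle_Delta_star coincides
   with same_perm_type. *)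
Lemma periodic_orbit_Delta_star (R : realType) (I : set R) (f : R -> R) (c : R)
    (O : set R) n (s : 'S_n) :
  unimodal I f c -> periodic_orbit I f O -> perm_type f O s -> Delta_star s.
Proof.
move=> [fI _ _ finc fdec] [x [p [Ix p0 fpx OE]]] [Om [[[OmO Ominj Omsurj] Omlt] fOm]].
have OI y : O y -> I y.
  rewrite OE => -[k _ <-]; elim: k => //= k IHk; exact: fI.
have OmI i : I (Om i) by apply/OI/OmO.
have [i0 _ i0x] : (Om @` setT) x by apply: Omsurj; rewrite OE; exists 0%N.
have Omit k : iter k f x = Om ((s ^+ k)%g i0).
  elim: k => [|k IHk] /=; first by rewrite expg0 perm1.
  by rewrite IHk fOm expgSr permM.
have ltE (i j : 'I_n) : (Om i < Om j) = (i < j)%N.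
  apply/idP/idP; last exact: Omlt.
  apply: contraTT; rewrite -leqNgt leq_eqVlt => /orP[/eqP/val_inj->|/Omlt/ltW].
    by rewrite ltxx.
  by rewrite leNgt.
have inc (i j : 'I_n) : (i < j)%N -> Om j <= c -> (s i < s j)%N.
  move=> ij jc; rewrite -ltE -!fOm; have ijO := Omlt _ _ ij; apply: finc => //;
    rewrite in_setE /=; split=> //; exact: ltW (lt_le_trans ijO jc).
have dec (i j : 'I_n) : (i < j)%N -> c <= Om i -> (s j < s i)%N.
  move=> ij jc; rewrite -ltE -!fOm; have ijO := Omlt _ _ ij; apply: fdec => //;
    rewrite in_setE /=; split=> //; exact: ltW (le_lt_trans jc ijO).
split; last first.
  have tot j : j \in porbit s i0.
    have : O (Om j) by exact: OmO.
    rewrite OE => -[k _]; rewrite Omit => /Ominj.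
    by rewrite !in_setE => /(_ Logic.I Logic.I) <-; exact: mem_porbit.
  apply/eqP/cards1P; exists (porbit s i0); apply/setP => B; rewrite inE.
  apply/imsetP/eqP => [[j _ ->]|->]; last by exists i0.
  by apply/eqP; rewrite eq_porbit_mem; exact: tot.
have n0 : (0 < n)%N by exact: leq_ltn_trans (ltn_ord i0).
have nl : (n.-1 < n)%N by rewrite prednK.
pose m := (s^-1)%g (Ordinal nl).
have sm : s m = Ordinal nl by rewrite permKV.
have smax i : (s i <= s m)%N by rewrite sm /= -ltnS prednK.
have slt i : i != m -> (s i < s m)%N.
  move=> im; rewrite ltn_neqAle smax andbT.
  by apply: contra im => /eqP/val_inj/perm_inj->.
exists m; split=> a b.
- move=> /andP[ab bm]; have [bc|/ltW cb] := leP (Om b) c; first exact: inc.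
  move: bm; rewrite leq_eqVlt => /orP[/eqP/val_inj bm|bm].
    by rewrite bm slt //; apply: contraTneq ab => ->; rewrite bm ltnn.
  by have := dec _ _ bm cb; rewrite ltnNge smax.
- move=> /andP[ma ab]; have [ca|/ltW ac] := leP c (Om a); first exact: dec.
  move: ma; rewrite leq_eqVlt => /orP[/eqP/val_inj ma|ma].
    by rewrite -ma slt //; apply: contraTneq ab => ->; rewrite ma ltnn.
  by have := inc _ _ ma ac; rewrite ltnNge smax.
Qed.

(* Main.v *)
Require Import Defs.
From mathcomp Require Import all_boot all_order all_algebra all_fingroup.
From mathcomp Require Import all_classical all_reals all_analysis.
Import Order.TTheory GRing.Theory Num.Theory.
Import numFieldNormedType.Exports.

(** Code each point of the union of the orbits by the side of the turning point
    on which it lies, giving the turning point, if it occurs, the side shared by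
    [m i] and [m' i]; the cycles of the two unions then carry the same codes.
    The order of two points with different itineraries is determined by these
    itineraries. The points with equal itineraries form classes, which the map
    permutes, and from one class to the next it is increasing for both unions or
    decreasing for both. Hence points of equal rank in the two unions have equal
    itineraries and equal positions in their classes, so their images also have
    equal ranks. The resulting bijection of the unions need not carry each orbit
    to the orbit with the same index. *)

(* The placement [P] of the points on a line makes [sg] unimodal; [e] marks the
   points on the increasing side of the turning point. *)
Definition folded {d : Order.disp_t} {T : orderType d} {X : finType}
    (sg : {perm X}) (e : X -> bool) (P : X -> T) : Prop :=
  [/\ injective P,
      forall x y, e x -> ~~ e y -> (P x < P y)%O,
      forall x y, e x -> e y -> (P x < P y)%O -> (P (sg x) < P (sg y))%O &
      forall x y, ~~ e x -> ~~ e y -> (P x < P y)%O ->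
        (P (sg y) < P (sg x))%O].

Definition same_itinerary {X : finType} (sg : {perm X}) (e : X -> bool)
    (x y : X) : bool :=
  `[< forall k, e (iter k sg x) = e (iter k sg y) >].

Definition rank {d : Order.disp_t} {T : orderType d} {X : finType}
    (P : X -> T) (x : X) : nat := #|[set z | (P z < P x)%O]|.

(** * Itineraries and the action of the map on their classes *)

Section Itineraries.
Context {X : finType} {sg : {perm X}} {e : X -> bool}.
Local Notation sim := (same_itinerary sg e).

Lemma same_itinerary_refl x : sim x x.
Proof. exact/asboolP. Qed.

Lemma same_itinerary_sym x y : sim x y = sim y x.
Proof. by apply/asboolP/asboolP => h k; rewrite h. Qed.

Lemma same_itinerary_trans x y z : sim x y -> sim y z -> sim x z.
Proof. by move=> /asboolP h /asboolP h'; apply/asboolP => k; rewrite h. Qed.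

Lemma same_itinerary_side x y : sim x y -> e x = e y.
Proof. by move=> /asboolP /(_ 0%N). Qed.

Lemma same_itinerary_perm x y : sim (sg x) (sg y) = sim x y.
Proof.
apply/asboolP/asboolP => h k; last by rewrite -!iterSr.
(* Passing to [sg x] and [sg y] drops the first symbol of each itinerary; since [sg] has finite
   order, it reappears at time [#[sg]%g.-1]. *)
case: k => [|k]; last by rewrite !iterSr.
have itE z : iter #[sg]%g.-1 sg (sg z) = z.
  by rewrite -iterSr prednK ?order_gt0// -permX expg_order perm1.
by have /= := h #[sg]%g.-1; rewrite !itE.
Qed.

Context {d : Order.disp_t} {T : orderType d} {P : X -> T}.
Context (hP : folded sg e P).

Lemma folded_lt_perm_l x y : e x -> e y ->
  (P (sg x) < P (sg y))%O = (P x < P y)%O.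
Proof.
case: hP => injP _ inc _ ex ey; case: (ltgtP (P x) (P y)) => h.
- exact: inc.
- by apply/negbTE; rewrite -leNgt ltW// inc.
- by rewrite (injP _ _ h) ltxx.
Qed.

Lemma folded_lt_perm_r x y : ~~ e x -> ~~ e y ->
  (P (sg x) < P (sg y))%O = (P y < P x)%O.
Proof.
case: hP => injP _ _ dec ex ey; case: (ltgtP (P y) (P x)) => h.
- exact: dec.
- by apply/negbTE; rewrite -leNgt ltW// dec.
- by rewrite (injP _ _ h) ltxx.
Qed.

Lemma folded_lt_side x y : e x != e y -> (P x < P y)%O = e x.
Proof.
case: hP => _ lr _ _; case ex: (e x); case ey: (e y) => // _.
- by apply: lr; rewrite ?ex ?ey.
- by apply/negbTE; rewrite -leNgt ltW// lr ?ex ?ey.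
Qed.

(** The first summand will turn out to depend on itineraries alone; the second is the position of
    [x] within its class. *)
Lemma rank_split x : rank P x =
  (#|[set z | ~~ sim z x & (P z < P x)%O]| +
   #|[set z | sim z x & (P z < P x)%O]|)%N.
Proof.
rewrite addnC /rank -[LHS](cardsID [set z | sim z x]).
by congr (_ + _)%N; apply: eq_card => z; rewrite !inE// andbC.
Qed.

(** A class lies on one side of the turning point, so [sg] is monotone on it. In the decreasing case
    the points below [sg x] come from those above [x], and the successor excludes [x] itself. *)
Lemma card_class_below_perm x :
  #|[set z | sim z (sg x) & (P z < P (sg x))%O]| =
  if e x then #|[set z | sim z x & (P z < P x)%O]|
  else (#|[set z | sim z x]| - #|[set z | sim z x & (P z < P x)%O]|.+1)%N.
Proof.
case: hP => injP _ _ _.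
have -> : [set z | sim z (sg x) & (P z < P (sg x))%O] =
    sg @: [set w | sim w x & (P (sg w) < P (sg x))%O].
  apply/setP => z; apply/idP/imsetP => [|[w + ->]].
    rewrite inE => h; exists ((sg^-1)%g z); last by rewrite permKV.
    by rewrite inE -same_itinerary_perm permKV.
  by rewrite !inE same_itinerary_perm.
rewrite card_imset; last exact: perm_inj.
case: ifPn => ex.
  apply: eq_card => w; rewrite !inE; apply: andb_id2l => swx.
  by rewrite folded_lt_perm_l// (same_itinerary_side _ _ swx).
have -> : [set w | sim w x & (P (sg w) < P (sg x))%O] =
    [set w | sim w x & (P x < P w)%O].
  apply/setP => w; rewrite !inE; apply: andb_id2l => swx.
  by rewrite folded_lt_perm_r// (same_itinerary_side _ _ swx).
have -> : [set w | sim w x & (P x < P w)%O] =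
    [set z | sim z x] :\: (x |: [set z | sim z x & (P z < P x)%O]).
  apply/setP => w; rewrite !inE negb_or negb_and.
  case: (sim w x) => /=; last by rewrite andbF.
  by rewrite andbT -leNgt lt_neqAle eq_sym (inj_eq injP).
rewrite cardsD (finset.setIidPr _) ?cardsU1 ?inE ?ltxx ?andbF//.
apply/fintype.subsetP => z; rewrite !inE => /orP[/eqP->|/andP[]//].
exact: same_itinerary_refl.
Qed.

End Itineraries.

(** * Two placements with the same codes *)

Section Comparison.
Context {X : finType} {sg : {perm X}} {e : X -> bool}.
Local Notation sim := (same_itinerary sg e).

(* The first index where the itineraries differ decides the order, with the sign
   given by the common prefix, whatever the placement. *)
Lemma folded_lt_itinerary {d d' : Order.disp_t} {T : orderType d}
    {T' : orderType d'} {P : X -> T} {P' : X -> T'} {x y x' y' : X} :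
  folded sg e P -> folded sg e P' -> sim x x' -> sim y y' -> ~~ sim x y ->
  (P x < P y)%O = (P' x' < P' y')%O.
Proof.
move=> hP hP' + + /asboolPn/existsNP[k].
elim: k x y x' y' => [|k IHk] x y x' y' sx sy.
  move=> /eqP exy; rewrite (folded_lt_side hP)// (folded_lt_side hP') //.
    exact: same_itinerary_side sx.
  by rewrite -(same_itinerary_side _ _ sx) -(same_itinerary_side _ _ sy).
have ex := same_itinerary_side _ _ sx; have ey := same_itinerary_side _ _ sy.
have [exy|exy _] := eqVneq (e x) (e y); last first.
  by rewrite (folded_lt_side hP)// (folded_lt_side hP') // -ex -?ey.
rewrite !iterSr => hk.
have [ex1|ex1] := boolP (e x).
  rewrite -(folded_lt_perm_l hP x y) -?exy //.
  by rewrite -(folded_lt_perm_l hP' x' y') -?ex -?ey -?exy //;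
    apply: IHk; rewrite ?same_itinerary_perm.
rewrite -(folded_lt_perm_r hP y x) -?exy //.
rewrite -(folded_lt_perm_r hP' y' x') -?ex -?ey -?exy //.
by apply: IHk; rewrite ?same_itinerary_perm // => h; apply: hk.
Qed.

(** Itineraries put [x] before [y] for [P'] too. Every point below [x] for [P] is below [y] for
    [P'], and [x] itself makes this inclusion strict. *)
Lemma rank_lt_itinerary {d d' : Order.disp_t} {T : orderType d}
    {T' : orderType d'} {P : X -> T} {P' : X -> T'} {x y : X} :
  folded sg e P -> folded sg e P' -> ~~ sim x y -> (P x < P y)%O ->
  (rank P x < rank P' y)%N.
Proof.
move=> hP hP' nxy xy.
have xy' : (P' x < P' y)%O.
  by rewrite -(folded_lt_itinerary hP hP' _ _ nxy) ?same_itinerary_refl.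
apply: proper_card; apply/fintype.properP; split; last first.
  by exists x; rewrite !inE ?ltxx.
apply/fintype.subsetP => z; rewrite !inE => zx.
have [zy|nzy] := boolP (sim z y); last first.
  rewrite -(folded_lt_itinerary hP hP' _ _ nzy) ?same_itinerary_refl//.
  exact: lt_trans zx xy.
(* A point with the itinerary of [y] compares with [x] as [y] does, so it cannot lie below [x]. *)
have nzx : ~~ sim z x.
  apply: contra nxy => h; apply: same_itinerary_trans zy.
  by rewrite same_itinerary_sym.
move: zx; rewrite (folded_lt_itinerary hP hP zy (same_itinerary_refl _) nzx).
by rewrite ltNge ltW.
Qed.

Lemma eq_rank_same_itinerary {d d' : Order.disp_t} {T : orderType d}
    {T' : orderType d'} {P : X -> T} {P' : X -> T'} {x y : X} :
  folded sg e P -> folded sg e P' -> rank P x = rank P' y -> sim x y.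
Proof.
move=> hP hP' rxy; apply/negPn/negP => nxy.
have [injP _ _ _] := hP.
case: (ltgtP (P x) (P y)) => [xy|yx|/injP xy].
- by have := rank_lt_itinerary hP hP' nxy xy; rewrite rxy ltnn.
- have nyx : ~~ sim y x by rewrite same_itinerary_sym.
  suff yx' : (P' y < P' x)%O.
    by have := rank_lt_itinerary hP' hP nyx yx'; rewrite rxy ltnn.
  by rewrite -(folded_lt_itinerary hP hP' _ _ nyx) ?same_itinerary_refl.
- by rewrite xy same_itinerary_refl in nxy.
Qed.

(* [sg] maps an itinerary class onto an itinerary class, increasingly for both
   placements or decreasingly for both. *)
Lemma eq_rank_perm {d d' : Order.disp_t} {T : orderType d}
    {T' : orderType d'} {P : X -> T} {P' : X -> T'} {x y : X} :
  folded sg e P -> folded sg e P' -> rank P x = rank P' y ->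
  rank P (sg x) = rank P' (sg y).
Proof.
move=> hP hP' rxy; have sxy := eq_rank_same_itinerary hP hP' rxy.
have simE u v z : sim u v -> sim z u = sim z v.
  move=> uv; apply/idP/idP => h; apply: same_itinerary_trans h _ => //.
  by rewrite same_itinerary_sym.
have belowE u v : sim u v -> #|[set z | ~~ sim z u & (P z < P u)%O]| =
    #|[set z | ~~ sim z v & (P' z < P' v)%O]|.
  move=> uv; apply: eq_card => z; rewrite !inE (simE _ _ _ uv).
  apply: andb_id2l; rewrite -(simE _ _ _ uv) => nzu.
  exact: folded_lt_itinerary (same_itinerary_refl _) uv nzu.
move: rxy; rewrite !(rank_split (sg := sg) (e := e)) (belowE _ _ sxy).
move=> /addnI inE'.
rewrite (belowE (sg x) (sg y)) ?same_itinerary_perm//; congr (_ + _)%N.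
rewrite (card_class_below_perm hP) (card_class_below_perm hP') inE'.
rewrite (same_itinerary_side _ _ sxy); congr (if _ then _ else (_ - _)%N).
by apply: eq_card => z; rewrite !inE (simE _ _ _ sxy).
Qed.

End Comparison.

(** * From ranks to permutation types *)

Lemma rank_ltn {d : Order.disp_t} {T : orderType d} {X : finType}
    (P : X -> T) x y : (P x < P y)%O -> (rank P x < rank P y)%N.
Proof.
move=> xy; apply: proper_card; apply/fintype.properP; split.
  by apply/fintype.subsetP => z; rewrite !inE => /lt_trans; exact.
by exists x; rewrite !inE ?ltxx.
Qed.

Lemma rank_lt_card {d : Order.disp_t} {T : orderType d} {X : finType}
    (P : X -> T) x : (rank P x < #|X|)%N.
Proof.
by rewrite -cardsT; apply: proper_card; apply/fintype.properP; split;
  [exact: finset.subsetT | exists x; rewrite !inE ?ltxx].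
Qed.

(** Ranks are distinct and below [#|X|], so they exhaust ['I_#|X|]; [g] lists [X] in the order of
    [P]. *)
Lemma rank_inverse {d : Order.disp_t} {T : orderType d} {X : finType}
    (P : X -> T) : injective P ->
  exists g : 'I_#|X| -> X, (forall i, rank P (g i) = i) /\
                           (forall x (i : 'I_#|X|), rank P x = i -> g i = x).
Proof.
move=> injP; pose rk x := Ordinal (rank_lt_card P x).
have rk_inj : injective rk.
  move=> x y /(congr1 val)/= rxy; apply: injP.
  by case: (ltgtP (P x) (P y)) => // /rank_ltn; rewrite rxy ltnn.
have [|g rkK gK] := inj_card_bij rk_inj; first by rewrite card_ord.
exists g; split=> [i|x i rxi]; first by rewrite -[in RHS](gK i).
by rewrite -(rkK x); congr g; apply: val_inj.
Qed.

Local Open Scope classical_set_scope.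
Local Open Scope ring_scope.

Lemma increasing_bij_range {R : realType} {X : finType} {P : X -> R}
    {g : 'I_#|X| -> X} : injective P -> (forall i, rank P (g i) = i) ->
  (forall x (i : 'I_#|X|), rank P x = i -> g i = x) ->
  increasing_bij (range P) (P \o g).
Proof.
move=> injP rg gr; split; [split|].
- by move=> i _; exists (g i).
- by move=> i j _ _ /injP gij; apply: val_inj; rewrite /= -rg gij rg.
- move=> _ [x _ <-]; exists (Ordinal (rank_lt_card P x)) => //=.
  by rewrite (gr x).
- move=> i j ij /=; rewrite ltNge le_eqVlt; apply/negP => /orP[/eqP/injP gij|].
    by move: ij; rewrite -[val i]rg -[val j]rg gij ltnn.
  by move/rank_ltn; rewrite !rg ltnNge ltnW.
Qed.

Lemma folded_same_perm_type {R : realType} {X : finType} {sg : {perm X}}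
    {e : X -> bool} {P P' : X -> R} {f f' : R -> R} :
  folded sg e P -> folded sg e P' ->
  (forall x, f (P x) = P (sg x)) -> (forall x, f' (P' x) = P' (sg x)) ->
  same_perm_type f (range P) f' (range P').
Proof.
move=> hP hP' fP fP'; have [injP _ _ _] := hP; have [injP' _ _ _] := hP'.
have [g [rg gr]] := rank_inverse _ injP.
have [g' [rg' gr']] := rank_inverse _ injP'.
(* This is [sg] read through the ranks of [P]; by [eq_rank_perm] the ranks of [P'] give the same
   permutation. *)
pose s0 i := Ordinal (rank_lt_card P (sg (g i))).
have gs0 i : g (s0 i) = sg (g i) by exact: gr.
have s0_inj : injective s0.
  move=> i j /(congr1 g); rewrite !gs0 => /perm_inj gij.
  by apply: val_inj; rewrite /= -rg gij rg.
exists #|X|, (perm s0_inj); split.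
- exists (P \o g); split; first exact: increasing_bij_range.
  by move=> i /=; rewrite fP permE gs0.
- exists (P' \o g'); split; first exact: increasing_bij_range.
  move=> i /=; rewrite fP' permE; congr P'; apply/esym/gr'.
  by apply/esym/(eq_rank_perm hP hP'); rewrite rg rg'.
Qed.

(** * Periodic orbits and the turning point *)

Lemma periodic_orbit_sub {R : realType} {I : set R} {f : R -> R} {O : set R} :
  set_fun I I f -> periodic_orbit I f O -> O `<=` I.
Proof.
move=> fI [x [p [Ix _ _ ->]]] _ [k _ <-].
by elim: k => //= k IHk; exact: fI.
Qed.

(** Serves to show that orbits sharing a point coincide. *)
Lemma periodic_orbit_gen {R : realType} {I : set R} {f : R -> R} {O : set R}
    {y : R} : periodic_orbit I f O -> O y -> O = range (fun k => iter k f y).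
Proof.
move=> [x [p [_ p0 fpx ->]]] [k _ <-].
have fpn n : iter (n * p) f x = x.
  by elim: n => // n IHn; rewrite mulSn iterD IHn.
apply/seteqP; split=> _ [j _ <-]; last by exists (j + k)%N => //; rewrite iterD.
(* After [k * p - k] further steps [iter k f x] is back at [x]; [0 < p] keeps the subtraction from
   truncating. *)
exists (j + (k * p - k))%N => //; rewrite -iterD -addnA subnK ?iterD ?fpn//.
by rewrite leq_pmulr.
Qed.

Lemma perm_type_maximum {R : realType} {f : R -> R} {O : set R} {n : nat}
    {s : 'S_n} {Om : 'I_n -> R} {m : R} :
  increasing_bij O Om -> (forall i, f (Om i) = Om (s i)) -> max_point f O m ->
  exists a, Om a = m /\ forall b, (s b <= s a)%N.
Proof.
move=> [[OmO _ Omsurj] Omlt] fOm [Om_ [_ mmax]].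
have [a _ am] := Omsurj _ Om_; exists a; split=> // b.
rewrite leqNgt; apply/negP => /Omlt; rewrite -!fOm am ltNge => /negP; apply.
by apply: mmax; rewrite fOm; exact: OmO.
Qed.

Lemma increasing_bij_inj {R : realType} {O : set R} {n : nat}
    {Om : 'I_n -> R} : increasing_bij O Om -> injective Om.
Proof. by move=> [[_ inj _] _] i j; apply: inj; rewrite in_setE. Qed.

(** A point left of the maximum point but beyond [c] would have a larger image, since [f] decreases
    there; the other case is symmetric. So [s] fixes the side of every point except the maximum
    point. *)
Lemma max_point_side {R : realType} {I : set R} {f : R -> R} {c : R}
    {O : set R} {n : nat} {s : 'S_n} {Om : 'I_n -> R} {a b : 'I_n} :
  unimodal I f c -> O `<=` I -> increasing_bij O Om ->
  (forall i, f (Om i) = Om (s i)) -> (forall i, (s i <= s a)%N) ->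
  ((b < a)%N -> Om b <= c) /\ ((a < b)%N -> c <= Om b).
Proof.
move=> [_ _ _ finc fdec] OI [[OmO _ _] Omlt] fOm smax.
have le i : Om (s i) <= Om (s a).
  have := smax i; rewrite leq_eqVlt => /orP[/eqP/val_inj->//|/Omlt/ltW//].
have OmI i : I (Om i) by apply/OI/OmO.
split=> /Omlt ab; rewrite leNgt; apply/negP => cb;
  have := le b; rewrite -!fOm leNgt => /negP; apply.
- by apply: fdec => //; rewrite in_setE /=; split=> //; apply: ltW => //;
    apply: lt_trans ab.
- by apply: finc => //; rewrite in_setE /=; split=> //; apply: ltW => //;
    apply: lt_trans cb.
Qed.

(** Weak inequalities suffice: by injectivity at most one point sits at [c], and it carries a single
    code. *)
Lemma unimodal_folded {R : realType} {I : set R} {f : R -> R} {c : R}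
    {X : finType} {sg : {perm X}} {e : X -> bool} {P : X -> R} :
  unimodal I f c -> injective P -> (forall x, I (P x)) ->
  (forall x, f (P x) = P (sg x)) ->
  (forall x, if e x then P x <= c else c <= P x) -> folded sg e P.
Proof.
move=> [_ _ _ finc fdec] injP PI fP side; split=> // x y.
- have := side x; have := side y.
  case ex: (e x); case ey: (e y) => // cy xc _ _.
  rewrite lt_neqAle (le_trans xc cy) andbT; apply/eqP => /injP xy.
  by rewrite xy ey in ex.
- move=> ex ey xy; rewrite -!fP; have := side x; have := side y.
  by rewrite ex ey => cy cx; apply: finc => //; rewrite in_setE.
- move=> /negbTE ex /negbTE ey xy; rewrite -!fP; have := side x; have := side y.
  by rewrite ex ey => cy cx; apply: fdec => //; rewrite in_setE.
Qed.

(** * The union of the orbits as one permuted finite set *)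

Section Union.
Context {r : nat} {n : 'I_r -> nat}.

Lemma tagged_perm_inj (s : forall i, 'S_(n i)) :
  injective (fun x : {i & 'I_(n i)} =>
    Tagged (fun i => 'I_(n i)) (s (tag x) (tagged x))).
Proof.
apply: (can_inj (g := fun x =>
  Tagged (fun i => 'I_(n i)) ((s (tag x))^-1%g (tagged x)))) => -[i a].
by rewrite /= permK.
Qed.

Context {R : realType} {I : set R} {f : R -> R} {O : 'I_r -> set R}.
Context {Om : forall i, 'I_(n i) -> R}.

Lemma tagged_orbits_inj : (forall i, periodic_orbit I f (O i)) ->
  injective O -> (forall i, increasing_bij (O i) (Om i)) ->
  injective (fun x : {i & 'I_(n i)} => Om (tag x) (tagged x)).
Proof.
move=> hO injO hOm [i a] [j b] /= ab.
have inO k d : O k (Om k d) by have [[h _ _] _] := hOm k; exact: h.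
have ij : i = j.
  apply: injO; rewrite (periodic_orbit_gen (hO i) (inO i a)).
  by rewrite (periodic_orbit_gen (hO j) (inO j b)) ab.
by subst j; rewrite (increasing_bij_inj (hOm i) _ _ ab).
Qed.

(** The permutation and the code involve only [s], [a] and [side], not [f] or [Om], so both maps can
    share them. *)
Lemma tagged_orbits_folded {c : R} {s : forall i, 'S_(n i)}
    {a : forall i, 'I_(n i)} {side : 'I_r -> bool} :
  unimodal I f c -> (forall i, periodic_orbit I f (O i)) -> injective O ->
  (forall i, increasing_bij (O i) (Om i)) ->
  (forall i b, f (Om i b) = Om i (s i b)) ->
  (forall i b, (s i b <= s i (a i))%N) ->
  (forall i, if side i then Om i (a i) <= c else c <= Om i (a i)) ->
  folded (perm (tagged_perm_inj s))
    (fun x => (tagged x < a (tag x))%N ||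
              (tagged x == a (tag x)) && side (tag x))
    (fun x : {i & 'I_(n i)} => Om (tag x) (tagged x)).
Proof.
move=> hf hO injO hOm fOm amax hside; have [fI _ _ _ _] := hf.
have OI i := periodic_orbit_sub fI (hO i).
apply: (unimodal_folded hf); first exact: (tagged_orbits_inj hO injO hOm).
- by move=> [i b]; apply: (OI i); have [[h _ _] _] := hOm i; exact: h.
- by move=> x; rewrite permE fOm.
move=> [i b] /=; rewrite -val_eqE /=.
have [lt gt] := max_point_side (b := b) hf (OI i) (hOm i) (fOm i) (amax i).
case: (ltngtP b (a i)) => [/lt|/gt|/val_inj ->] //=.
Qed.

Lemma bigcup_tagged_range : (forall i, increasing_bij (O i) (Om i)) ->
  \bigcup_i O i = range (fun x : {i & 'I_(n i)} => Om (tag x) (tagged x)).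
Proof.
move=> hOm; apply/seteqP; split=> [y [i _ Oy]|_ [[i a] _ <-]].
  have [[_ _ h] _] := hOm i; have [a _ <-] := h _ Oy.
  by exists (Tagged (fun i => 'I_(n i)) a).
by exists i => //; have [[h _ _] _] := hOm i; exact: h.
Qed.

End Union.

Theorem mainTheorem4 (R : realType) (I : set R) (hI : is_interval I)
  (f f' : R -> R) (c c' : R)
  (hf : unimodal I f c) (hf' : unimodal I f' c')
  (r : nat) (O O' : 'I_r -> set R)
  (hO : forall i, periodic_orbit I f (O i)) (hO_inj : injective O)
  (hO' : forall i, periodic_orbit I f' (O' i)) (hO'_inj : injective O')
  (m m' : 'I_r -> R)
  (hm : forall i, max_point f (O i) (m i))
  (hm' : forall i, max_point f' (O' i) (m' i))
  (h_type : forall i, same_cycle_Delta_star f (O i) f' (O' i))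
  (h_side : forall i, (m i <= c /\ m' i <= c') \/ (c <= m i /\ c' <= m' i)) :
  same_perm_type f (\bigcup_i O i) f' (\bigcup_i O' i).
Proof.
have /all_tag[n /all_sig[s]] : forall i, {n & {s : 'S_n |
    exists Om Om' : 'I_n -> R,
    [/\ increasing_bij (O i) Om, forall a, f (Om a) = Om (s a),
        increasing_bij (O' i) Om' & forall a, f' (Om' a) = Om' (s a)]}}.
  move=> i; have /cid[n /cid[s [_ h h']]] := h_type i.
  exists n, s; have [Om [? ?]] := h; have [Om' [? ?]] := h'.
  by exists Om, Om'.
move=> /(_ _)/cid-/all_sig[Om] /(_ _)/cid-/all_sig[Om' hOm].
have OmB i : increasing_bij (O i) (Om i) by have [] := hOm i.
have OmB' i : increasing_bij (O' i) (Om' i) by have [] := hOm i.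
have fOm i : forall a, f (Om i a) = Om i (s i a) by have [] := hOm i.
have fOm' i : forall a, f' (Om' i a) = Om' i (s i a) by have [] := hOm i.
have /all_sig[a ha] : forall i, {a | [/\ Om i a = m i, Om' i a = m' i &
    forall b, (s i b <= s i a)%N]}.
  move=> i; apply: cid.
  have [a [am amax]] := perm_type_maximum (OmB i) (fOm i) (hm i).
  have [a' [am' amax']] := perm_type_maximum (OmB' i) (fOm' i) (hm' i).
  exists a; split=> //; rewrite -am'; congr (Om' i).
  (* Both [a] and [a'] are sent by [s i] to its largest value. *)
  apply: (@perm_inj _ (s i)); apply: val_inj; apply/eqP.
  by rewrite eqn_leq amax amax'.
rewrite (bigcup_tagged_range OmB) (bigcup_tagged_range OmB').
(* A side common to both maps; the left one is taken when both alternatives of [h_side] hold. *)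
pose side i := `[< m i <= c /\ m' i <= c' >].
apply: folded_same_perm_type.
- apply: (tagged_orbits_folded (a := a) (side := side) hf hO) => // i.
    by have [] := ha i.
  have [-> _ _] := ha i; rewrite /side.
  by case: asboolP => [[]//|]; have [|[]] := h_side i.
- apply: (tagged_orbits_folded (a := a) (side := side) hf' hO') => // i.
    by have [] := ha i.
  have [_ -> _] := ha i; rewrite /side.
  by case: asboolP => [[]//|]; have [|[]] := h_side i.
- by move=> x; rewrite permE fOm.
- by move=> x; rewrite permE fOm'.
Qed.
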